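(* Let $d_1,d_2\in\mathbb N$ (positive integers), let $x_1,\ldots,x_{d_1}\in\mathbb R$ be distinct, and let $D:=d_1+2d_2-1$. Let $\gamma=(\gamma_0,\ldots,\gamma_D)\in\mathbb R^{D+1}$ be a sequence such that the moment matrix $M_{\lfloor D/2\rfloor}=(\gamma_{i+j-2})_{i,j=1}^{\lfloor D/2\rfloor+1}$ is positive definite. Let $e_i:=e_i(x_1,\ldots,x_{d_1})$ be the elementary symmetric polynomials of the $x_j$, and let $$f(x):=\prod_{i=1}^{d_1}(x-x_i)=\sum_{i=0}^{d_1}(-1)^ie_i\,x^{d_1-i}.$$ The following statements are equivalent: (1) There exists a $(d_1+d_2)$-atomic $\mathbb R$-representing measure for $\gamma$ with $d_1$ of its atoms equal to $x_1,\ldots,x_{d_1}$. (2) Both of the following conditions hold: (a) The localizing matrix $\mathcal H_f(d_2-1)$ is invertible. (b) Set $$(\lambda_0,\lambda_1,\ldots,\lambda_{d_2-1})^T:=\big(\mathcal H_f(d_2-1)\big)^{-1}\Big(\sum_{i=0}^{d_1}(-1)^ie_i\,\mathbf v^{(d_2-1)}_{d_1+d_2-i}\Big),\qquad g(x):=x^{d_2}-\sum_{i=0}^{d_2-1}\lambda_ix^i,$$ $$h(x):=f(x)g(x)=x^{d_1+d_2}-\sum_{i=0}^{d_1+d_2-1}\varphi_ix^i$$ (the last equality defines the real numbers $\varphi_i$). Let $\widetilde\gamma=(\widetilde\gamma_u)_{u=0}^{D+d_1-1}$ be the extension of $\gamma$ defined by $\widetilde\gamma_u=\gamma_u$ for $0\le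 u\le D$ and $$\widetilde\gamma_{D+\ell}=\sum_{i=1}^{d_1+d_2}\varphi_{d_1+d_2-i}\,\widetilde\gamma_{D+\ell-i}\qquad\text{for }\ell=1,\ldots,d_1-1.$$ Then the moment matrix $M_{d_1+d_2-1}=(\widetilde\gamma_{i+j-2})_{i,j=1}^{d_1+d_2}$ of $\widetilde\gamma$ is positive definite. Moreover, if the equivalent statements (1), (2) hold, then the other atoms in the measure are the zeros of the polynomial $g$.
   Context: Measures: an $N$-atomic positive measure on $\mathbb R$ is $\mu=\sum_{j=1}^N\rho_j\delta_{y_j}$ with distinct atoms $y_j\in\mathbb R$ and densities $\rho_j>0$. It is an $\mathbb R$-representing measure for $\gamma=(\gamma_0,\ldots,\gamma_D)$ if $\gamma_i=\int_{\mathbb R}x^i\,d\mu$ for all $0\le i\le D$. Riesz functional: $L:\mathbb R[x]_{\le D}\to\mathbb R$ is the linear functional with $L(x^i)=\gamma_i$. Localizing matrix: for a polynomial $f$ of degree at most $D$, put $\gamma^{(f)}_i:=L(f\,x^i)$ for $0\le i\le D-\deg f$, and $\mathcal H_f(\ell):=\big(\gamma^{(f)}_{i+j-2}\big)_{i,j=1}^{\ell+1}$, an $(\ell+1)\times(\ell+1)$ matrix. Vectors: $\mathbf v_i^{(j)}:=(\gamma_i,\gamma_{i+1},\ldots,\gamma_{i+j})^T\in\mathbb R^{j+1}$. Elementary symmetric polynomials: $e_0=1$ and $e_i(x_1,\ldots,x_{d_1})=\sum_{1\le j_1<\cdots<j_i\le d_1}x_{j_1}\cdots x_{j_i}$. 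*)

(* Defs.v *)
From HB Require Import structures.
From mathcomp Require Import all_boot all_order all_algebra.
From mathcomp Require Import all_classical all_reals all_analysis.

Set Implicit Arguments.
Unset Strict Implicit.
Unset Printing Implicit Defensive.

Import Order.TTheory GRing.Theory Num.Theory.
Import numFieldNormedType.Exports.

Local Open Scope classical_set_scope.
Local Open Scope ring_scope.

(* A truncated moment sequence (s_0, ..., s_D) is the list of its D.+1 entries,
   with s`_i the i-th one; the default value 0 of s`_i beyond the end of the
   list plays no role below, all indices used being at most D. *)

Section Algebra.
Variable R : realType.
Implicit Types (s : seq R) (p : {poly R}).

Definition posdefmx n (A : 'M[R]_n) : Prop :=
  A^T = A /\ forall u : 'cV[R]_n, u != 0 -> 0 < (u^T *m A *m u) 0 0.

Definition moment_mx s k : 'M[R]_k.+1 := \matrix_(i, j) s`_(i + j).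

Definition riesz s p : R := \sum_(i < size p) p`_i * s`_i.

Definition localizing_mx s p l : 'M[R]_l.+1 :=
  \matrix_(i, j) riesz s (p * 'X^(i + j)).

Definition moment_vec s i j : 'cV[R]_j.+1 := \col_k s`_(i + k).

Definition elem_sym d (x : d.-tuple R) i : R :=
  \sum_(A : {set 'I_d} | #|A| == i) \prod_(j in A) tnth x j.

Definition node_poly d (x : d.-tuple R) : {poly R} :=
  \prod_(i < d) ('X - (tnth x i)%:P).

Section Construction.
Variables (d1 d2 : nat) (x : d1.-tuple R) (s : seq R).

(* The localizing matrix H_f(d2 - 1), of size d2 (for d2 > 0). *)
Definition Hf : 'M[R]_(d2.-1.+1) := localizing_mx s (node_poly x) d2.-1.

(* Meaningful when Hf is invertible, as invmx is the identity otherwise. *)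
Definition lambda : 'cV[R]_(d2.-1.+1) :=
  invmx Hf *m
  \sum_(i < d1.+1)
     ((-1) ^+ i * elem_sym x i) *: moment_vec s (d1 + d2 - i)%N d2.-1.

Definition gpoly : {poly R} := 'X^d2 - \sum_(i < d2.-1.+1) lambda i 0 *: 'X^i.

Definition hpoly : {poly R} := node_poly x * gpoly.

Definition phi (i : nat) : R := ('X^(d1 + d2) - hpoly)`_i.

(* Appends one term to t by the recursion; that term has index size t. *)
Definition extend1 (t : seq R) : seq R :=
  rcons t (\sum_(1 <= i < (d1 + d2).+1)
             phi (d1 + d2 - i) * t`_(size t - i)).

Definition extension : seq R := iter d1.-1 extend1 s.

End Construction.
End Algebra.

Section Measures.
Variable R : realType.
Implicit Types mu : {measure set (measurableTypeR R) -> \bar R}.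

(* mu is the N-atomic measure \sum_j rho_j \delta_{y_j} for some rho_j > 0. *)
Definition atomic_measure N mu (y : N.-tuple R) : Prop :=
  uniq y /\
  exists rho : 'I_N -> R, (forall j, 0 < rho j) /\
    forall A : set (measurableTypeR R), measurable A ->
      mu A = (\sum_(j < N) (rho j)%:E * \d_(tnth y j) A)%E.

Definition represents mu (s : seq R) : Prop :=
  forall i, (i < size s)%N -> (\int[mu]_t (t ^+ i)%:E = (s`_i)%:E)%E.

(* mu represents s, and its atoms are the d1 + d2 entries of y, including those
   of x. *)
Definition representing_with_nodes d1 d2 (x : d1.-tuple R) (s : seq R) mu
    (y : (d1 + d2).-tuple R) : Prop :=
  [/\ atomic_measure mu y, represents mu s & {subset x <= y}].

End Measures.

(* Main.v *)
(* Write L for the Riesz functional, N = d1 + d2 and h = f g.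

   If mu represents gamma, then L(f p) only sees the d2 atoms outside x, so
   H_f(d2 - 1) is invertible and g, the only monic polynomial of degree d2 with
   L(f g q) = 0 for deg q < d2, is the nodal polynomial of these atoms.  Hence h
   vanishes on all atoms, the recursion produces the moments of mu, and L(p^2)
   is a positive combination of the p(y)^2.

   Conversely, the definition of lambda and the recursion together say that the
   extended functional satisfies L(h q) = 0 for deg q <= N - 2.  Positivity of
   L(p^2) for deg p < N then forces h to have N distinct real roots, since h has
   no factor (X - a)^2 + b^2, and the interpolatory quadrature at these roots has
   weights L(l_y^2) > 0, where l_y are the Lagrange polynomials.  It is exact in
   degree <= 2 N - 2. *)

Require Import Defs.
From HB Require Import structures.
From mathcomp Require Import all_boot all_order all_algebra.
From mathcomp Require Import all_classical all_reals all_analysis.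
From mathcomp Require Import measurable_realfun.
From mathcomp Require Import ring lra zify.
From mathcomp Require complex.

Set Implicit Arguments.
Unset Strict Implicit.
Unset Printing Implicit Defensive.

Import Order.TTheory GRing.Theory Num.Theory.
Import numFieldNormedType.Exports.

Local Open Scope classical_set_scope.
Local Open Scope ring_scope.

(** * Real polynomials with no factor (X - a)^2 + b^2 *)

Section RealRooted.
Import complex.
Variable R : rcfType.
Implicit Types h : {poly R}.

(** Take a root a + ib over the complex extension of [R]. If b is nonzero, the remainder of [h]
    modulo (X - a)^2 + b^2 is real, of degree at most 1, and vanishes at a non-real number, so it is
    zero. *)
Lemma root_or_quadratic_dvdp h : size h != 1%N ->
  (exists a, root h a) \/ (exists a b, ('X - a%:P) ^+ 2 + (b ^+ 2)%:P %| h).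
Proof.
move=> sh; pose toC := real_complex R.
have /closed_rootP[z] : size (map_poly toC h) != 1%N by rewrite size_map_poly.
case: z => a b hz; have [b0|b0] := eqVneq b 0.
  by left; exists a; rewrite -(fmorph_root toC) /= -complexr0 -b0.
right; exists a, b; set p := _ + _.
have sp : size p = 3%N.
  rewrite size_polyDl ?size_exp_XsubC //.
  by rewrite (leq_ltn_trans (size_polyC_leq1 _)).
have pz : root (map_poly toC p) (Complex a b).
  rewrite /p rmorphD /= rmorphXn /= rmorphB /= map_polyX !map_polyC /= /root.
  rewrite !hornerE /= eq_complex /=.
  by apply/andP; split; apply/eqP; rewrite /=; ring.
have rz : root (map_poly toC (h %% p)) (Complex a b).
  move: hz; rewrite {1}(divp_eq h p) rmorphD rmorphM /= rootE hornerD hornerM.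
  by rewrite (rootP pz) mulr0 add0r.
have sr : (size (h %% p)%R <= 2)%N.
  by rewrite -ltnS -sp ltn_modp -size_poly_eq0 sp.
move: rz sr; rewrite /dvdp; move: (h %% p : {poly R}) => r rz sr.
have rE : r = (r`_0)%:P + r`_1 *: 'X.
  apply/polyP => i; rewrite !coefE.
  case: i => [|[|i]] /=; rewrite ?mulr0 ?mulr1 ?addr0 ?add0r //.
  by rewrite nth_default ?(leq_trans sr).
move: rz; rewrite rE rmorphD /= linearZ /= map_polyC map_polyX /= rootE.
rewrite hornerD hornerC hornerZ hornerX eq_complex /= => /andP[/eqP Re0 /eqP Im0].
have r1 : r`_1 = 0.
  by apply: (mulIf b0); move: Im0; rewrite /=; lra.
by move: Re0; rewrite r1 !mul0r !subr0 addr0 => ->; rewrite scale0r addr0.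
Qed.

(** The case b = 0 of the hypothesis excludes double roots, so the roots are both real and simple;
    they are split off one by one. *)
Lemma real_rooted_split h : h \is monic ->
  (forall a b, ~~ (('X - a%:P) ^+ 2 + (b ^+ 2)%:P %| h)) ->
  exists2 r : seq R, uniq r & h = \prod_(z <- r) ('X - z%:P).
Proof.
have [n] := ubnP (size h); elim: n h => // n IHn h sh mh nh.
have [sh1|sh1] := eqVneq (size h) 1%N.
  exists [::] => //; rewrite big_nil; move: mh.
  by have /eqP/size_poly1P[c c0 ->] := sh1; rewrite monicE lead_coefC => /eqP->.
case: (root_or_quadratic_dvdp sh1) => [[a ha]|[a [b]]]; last by move/negP: (nh a b).
have [q hq] := factor_theorem _ _ ha.
have mq : q \is monic by move: mh; rewrite hq monicMr ?monicXsubC.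
have [||r ur qr] := IHn q _ mq.
- by move: sh; rewrite hq size_Mmonic ?monicXsubC ?monic_neq0 // size_XsubC addn2.
- move=> b c; apply: contra (nh b c) => /dvdp_trans; apply.
  by rewrite hq dvdp_mulr.
exists (a :: r); last by rewrite big_cons -qr mulrC.
rewrite /= ur andbT -root_prod_XsubC -qr; apply: contra (nh a 0) => /factor_theorem[p pq].
by rewrite hq pq -mulrA -expr2 expr0n /= addr0 dvdp_mull.
Qed.

End RealRooted.

(** * The Riesz functional L and the matrices attached to it *)

Section RieszFunctional.
Variable R : realType.
Implicit Types (s t : seq R) (f h p q : {poly R}).

(** [riesz] sums up to the size of its argument; a common bound for several polynomials gives
    linearity. *)
Lemma riesz_wide n s p : (size p <= n)%N ->
  riesz s p = \sum_(i < n) p`_i * s`_i.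
Proof.
move=> sp; rewrite /riesz (big_ord_widen _ (fun i => p`_i * s`_i) sp) big_mkcond.
apply: eq_bigr => i _; case: ltnP => // ip.
by rewrite [p`_i]nth_default ?mul0r.
Qed.

Lemma riesz_is_scalar s : scalar (riesz s).
Proof.
move=> a p q; pose n := maxn (size p) (size q).
rewrite !(@riesz_wide n) ?leq_maxl ?leq_maxr //; last first.
  rewrite (leq_trans (size_polyD _ _)) // geq_max leq_maxr andbT.
  by rewrite (leq_trans (size_scale_leq _ _)) ?leq_maxl.
rewrite mulr_sumr -big_split /=; apply: eq_bigr => i _.
by rewrite coefD coefZ mulrDl mulrA.
Qed.

HB.instance Definition _ s :=
  GRing.isLinear.Build R {poly R} R *%R (riesz s) (riesz_is_scalar s).

Lemma rieszXn s n : riesz s 'X^n = s`_n.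
Proof.
rewrite (@riesz_wide n.+1) ?size_polyXn // big_ord_recr /= big1 ?add0r.
  by rewrite coefXn eqxx mul1r.
by move=> i _; rewrite coefXn ltn_eqF ?mul0r.
Qed.

Lemma eq_riesz n s t p : (size p <= n)%N ->
  (forall i, (i < n)%N -> s`_i = t`_i) -> riesz s p = riesz t p.
Proof.
by move=> sp st; rewrite !(riesz_wide _ sp); apply: eq_bigr => i _; rewrite st.
Qed.

Lemma riesz_quadrature_sum (I : Type) (r : seq I) (w y : I -> R) n s p :
  (forall i, (i < n)%N -> s`_i = \sum_(j <- r) w j * y j ^+ i) ->
  (size p <= n)%N -> riesz s p = \sum_(j <- r) w j * p.[y j].
Proof.
move=> sw sp; rewrite (riesz_wide _ sp).
under eq_bigr do rewrite sw // mulr_sumr.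
rewrite exchange_big /=; apply: eq_bigr => j _.
by rewrite (horner_coef_wide _ sp) mulr_sumr; apply: eq_bigr => i _; ring.
Qed.

Lemma riesz_mul_expand s f q n : (size q <= n)%N ->
  riesz s (f * q) = \sum_(i < n) q`_i * riesz s (f * 'X^i).
Proof.
move=> sq; rewrite -{1}(take_poly_id sq) /take_poly poly_def mulr_sumr raddf_sum /=.
by apply: eq_bigr => i _; rewrite -scalerAr linearZ.
Qed.

Lemma riesz_mul_eq0 s f q n : (size q <= n)%N ->
  (forall i, (i < n)%N -> riesz s (f * 'X^i) = 0) -> riesz s (f * q) = 0.
Proof.
move=> sq f0; rewrite (riesz_mul_expand _ _ sq) big1 // => i _.
by rewrite f0 ?mulr0.
Qed.

(** Vectors are read as coefficient lists of polynomials of degree at most [l], which turns the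
    matrix conditions into conditions on L. *)
Lemma localizing_mulmx s f l (u : 'cV[R]_l.+1) i :
  (localizing_mx s f l *m u) i 0 = riesz s (f * 'X^i * rVpoly u^T).
Proof.
rewrite (@riesz_mul_expand _ _ _ l.+1) ?size_poly // mxE.
by apply: eq_bigr => j _; rewrite !mxE coef_rVpoly_ord mxE -mulrA -exprD mulrC.
Qed.

Lemma moment_mx_quad s k (u : 'cV[R]_k.+1) :
  (u^T *m moment_mx s k *m u) 0 0 = riesz s (rVpoly u^T * rVpoly u^T).
Proof.
have -> : moment_mx s k = localizing_mx s 1 k.
  by apply/matrixP => i j; rewrite !mxE mul1r rieszXn.
rewrite -mulmxA mxE (@riesz_mul_expand _ _ _ k.+1) ?size_poly //.
apply: eq_bigr => i _; rewrite localizing_mulmx mul1r mulrC.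
by rewrite coef_rVpoly_ord mulrC [rVpoly _ * _]mulrC.
Qed.

Lemma posdef_momentP s k :
  posdefmx (moment_mx s k) <->
  forall p, p != 0 -> (size p <= k.+1)%N -> 0 < riesz s (p * p).
Proof.
split=> [[_ pd] p p0 sp|pd].
  rewrite -(poly_rV_K sp) -[poly_rV p]trmxK -moment_mx_quad; apply: pd.
  apply: contra_neq p0 => /(congr1 trmx); rewrite trmxK trmx0.
  by move=> /(congr1 rVpoly); rewrite poly_rV_K // raddf0.
split; first by apply/matrixP => i j; rewrite !mxE addnC.
move=> u u0; rewrite moment_mx_quad pd ?size_poly //.
apply: contra_neq u0 => /(congr1 (@poly_rV _ k.+1)); rewrite rVpolyK raddf0.
by move=> /(congr1 trmx); rewrite trmxK trmx0.
Qed.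

Lemma localizing_unitmxP s f l :
  localizing_mx s f l \in unitmx <->
  forall p, (size p <= l.+1)%N ->
    (forall i, (i < l.+1)%N -> riesz s (f * p * 'X^i) = 0) -> p = 0.
Proof.
split=> [Hu p sp p0|H].
  have : localizing_mx s f l *m (poly_rV p)^T = 0.
    apply/matrixP => i j; rewrite ord1 localizing_mulmx trmxK poly_rV_K //.
    by rewrite mulrAC p0 // mxE.
  move/(congr1 (mulmx (invmx (localizing_mx s f l)))); rewrite mulKmx // mulmx0.
  move=> /(congr1 trmx); rewrite trmxK trmx0 => /(congr1 rVpoly).
  by rewrite poly_rV_K // raddf0.
(* [kermx] is a left kernel, spanned by its rows, hence the passage to the transpose. *)
rewrite -unitmx_tr -row_free_unit -kermx_eq0; apply/eqP/row_matrixP => i.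
set v := row i _; rewrite row0.
have /(congr1 trmx) : v *m (localizing_mx s f l)^T = 0.
  by rewrite -row_mul mulmx_ker row0.
rewrite trmx_mul trmxK trmx0 => Hv.
rewrite -[v]rVpolyK (H (rVpoly v)) ?size_poly ?raddf0 // => j jl.
have /matrixP/(_ (Ordinal jl) 0) := Hv.
by rewrite localizing_mulmx trmxK mxE /= mulrAC.
Qed.

End RieszFunctional.

(** * Gauss quadrature at the roots of an almost orthogonal polynomial *)

Section GaussQuadrature.
Variable R : realType.
Variables (s : seq R) (h : {poly R}) (n : nat).
Implicit Types (p q : {poly R}).
Hypothesis mh : h \is monic.
Hypothesis sh : size h = n.+3.
Hypothesis ortho : forall q, (size q <= n.+1)%N -> riesz s (h * q) = 0.
Hypothesis pd : forall p, p != 0 -> (size p <= n.+2)%N -> 0 < riesz s (p * p).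

(* If [h = ((X - a)^2 + b^2) q], then
   [0 = L(h q) = L(((X - a) q)^2) + b^2 L(q^2) > 0]. *)
Lemma ortho_no_quadratic_factor a b : ~~ (('X - a%:P) ^+ 2 + (b ^+ 2)%:P %| h).
Proof.
set m := _ + _.
have sm : size m = 3%N.
  rewrite size_polyDl ?size_exp_XsubC //.
  by rewrite (leq_ltn_trans (size_polyC_leq1 _)).
have mm : m \is monic.
  rewrite monicE lead_coefDl ?size_exp_XsubC.
    by rewrite lead_coef_exp lead_coefXsubC expr1n.
  by rewrite (leq_ltn_trans (size_polyC_leq1 _)).
apply/negP => /dvdpP[q hq].
have q0 : q != 0.
  by apply: contraTneq mh => q0; rewrite hq q0 mul0r monicE lead_coef0 eq_sym
    oner_eq0.
have sq : size q = n.+1.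
  by apply/eqP; rewrite -(eqn_add2r 2) !addn2 -sh hq size_Mmonic // sm addn3.
pose p := ('X - a%:P) * q.
have p0 : p != 0 by rewrite mulf_neq0 ?polyXsubC_eq0.
have sp : size p = n.+2 by rewrite size_monicM ?monicXsubC // size_XsubC sq.
have := ortho (eq_leq sq).
have -> : h * q = p * p + b ^+ 2 *: (q * q).
  by rewrite hq /m /p -mul_polyC; ring.
rewrite linearD linearZ /= => /eqP; apply/negP; rewrite gt_eqF //.
by rewrite ltr_pwDl ?pd ?sp // mulr_ge0 ?sqr_ge0 // ltW // pd // sq.
Qed.

(** Lagrange polynomials without normalisation; the value at [z] is divided out in the weights. *)
Let lag (r : seq R) (z : R) : {poly R} := \prod_(t <- rem z r) ('X - t%:P).

(** With N = n + 2 the degree of [h], orthogonality is assumed only up to degree N - 2, one less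
    than in the classical case, so exactness is claimed up to degree 2N - 2 instead of 2N - 1. *)
Lemma gauss_quadrature :
  exists (r : seq R) (w : R -> R),
    [/\ uniq r, h = \prod_(z <- r) ('X - z%:P), {in r, forall z, 0 < w z}
      & forall p, (size p <= n.*2 + 3)%N ->
          riesz s p = \sum_(z <- r) w z * p.[z]].
Proof.
have [r ur hr] := real_rooted_split mh ortho_no_quadratic_factor.
have sr : size r = n.+2.
  by move: sh; rewrite hr size_prod_XsubC => -[].
pose w z := riesz s (lag r z * lag r z) / (lag r z).[z] ^+ 2.
have hlag z : z \in r -> h = lag r z * ('X - z%:P).
  by move=> zr; rewrite hr (perm_big _ (perm_to_rem zr)) big_cons mulrC.
have slag z : z \in r -> size (lag r z) = n.+2.
  by move=> zr; rewrite size_prod_XsubC size_rem // sr.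
have lag0 z : z \in r -> (lag r z).[z] != 0.
  by move=> zr; rewrite -[_ == 0]/(root _ _) root_prod_XsubC mem_rem_uniqF.
have lag_other z t : z \in r -> t \in r -> t != z -> (lag r z).[t] = 0.
  by move=> zr tr tz; apply/rootP; rewrite root_prod_XsubC mem_rem_uniq // inE tz.
(* The form L(l^2) / l(z)^2 of [w z] shows positivity, whereas interpolation produces L(l) / l(z).
   They agree because l^2 - l(z) l = l (l - l(z)) is [h] times a polynomial of degree at most n. *)
have lag_sqr z : z \in r ->
    riesz s (lag r z * lag r z) = (lag r z).[z] * riesz s (lag r z).
  move=> zr; set l := lag r z.
  have [q lq] : exists q, l - l.[z]%:P = q * ('X - z%:P).
    by apply/factor_theorem; rewrite rootE !hornerE subrr.
  have sq : (size q <= n.+1)%N.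
    have [->|q0] := eqVneq q 0; first by rewrite size_poly0.
    have : (size (q * ('X - z%:P))%R <= n.+2)%N.
      rewrite -lq (leq_trans (size_polyD _ _)) // geq_max slag // size_polyN leqnn /=.
      by rewrite (leq_trans (size_polyC_leq1 _)).
    by rewrite size_Mmonic ?monicXsubC // size_XsubC addn2.
  have -> : l * l = h * q + l.[z] *: l.
    rewrite (hlag _ zr) -/l -mulrA [_ * q]mulrC -lq -mul_polyC; ring.
  by rewrite linearD linearZ /= ortho // add0r.
exists r, w; split => //.
  move=> z zr; rewrite divr_gt0 ?exprn_even_gt0 ?lag0 //.
  by rewrite pd ?slag // -size_poly_eq0 slag.
move=> p sp.
(* The quotient by [h] has degree at most n, so orthogonality removes it; at the roots of [h] it
   disappears as well. *)
have -> : riesz s p = riesz s (p %% h).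
  rewrite {1}(divp_eq p h) linearD /= [_ * h]mulrC ortho ?add0r //.
  by rewrite size_divp ?monic_neq0 // sh leq_subLR (leq_trans sp) //; lia.
have sc : (size (p %% h)%R <= n.+2)%N by rewrite -ltnS -sh ltn_modp monic_neq0.
have pc z : z \in r -> p.[z] = (p %% h).[z].
  move=> zr; rewrite {1}(divp_eq p h) hornerD hornerM.
  by rewrite (rootP (_ : root h z)) ?mulr0 ?add0r // hr root_prod_XsubC.
rewrite (eq_big_seq (fun z => w z * (p %% h).[z])); last by move=> z zr; rewrite pc.
move: (p %% h : {poly R}) sc => {pc sp p} c sc.
(* Lagrange interpolation: the difference has degree less than n + 2 and vanishes at n + 2 nodes. *)
have {1}-> : c = \sum_(z <- r) (c.[z] / (lag r z).[z]) *: lag r z.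
  apply/eqP; rewrite -subr_eq0; apply/eqP/(@roots_geq_poly_eq0 _ _ r) => //.
  - apply/allP => z zr; rewrite rootE !hornerE horner_sum (bigD1_seq z) //= big1_seq.
      by rewrite hornerZ addr0 divfK ?lag0 // subrr.
    by move=> t /andP[tz tr]; rewrite hornerZ (lag_other t z) ?mulr0 // eq_sym.
  - rewrite sr (leq_trans (size_polyD _ _)) // geq_max sc size_polyN.
    rewrite big_seq; apply: (big_ind (fun p : {poly R} => (size p <= n.+2)%N)).
    + by rewrite size_poly0.
    + by move=> p q sp sq; rewrite (leq_trans (size_polyD _ _)) // geq_max sp.
    + by move=> z zr; rewrite (leq_trans (size_scale_leq _ _)) // slag.
rewrite raddf_sum /=; apply: eq_big_seq => z zr; rewrite linearZ /= /w lag_sqr //.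
by field; exact: lag0.
Qed.

End GaussQuadrature.

(** * The polynomials f, g and h *)

Section Construction.
Variable R : realType.
Variables (d1 d2 : nat) (x : d1.-tuple R) (s : seq R).
Implicit Types (p q : {poly R}).

Lemma node_poly_prod : node_poly x = \prod_(z <- x) ('X - z%:P).
Proof. by rewrite big_tuple. Qed.

Lemma node_poly_monic : node_poly x \is monic.
Proof. by rewrite node_poly_prod monic_prod_XsubC. Qed.

Lemma size_node_poly : size (node_poly x) = d1.+1.
Proof. by rewrite node_poly_prod size_prod_XsubC size_tuple. Qed.

(** In the expanded product, [A] is the set of factors contributing -x_j. Terms are grouped by the
    cardinality of [A], which is at most d1, so [inord] is faithful. *)
Lemma node_poly_elem_sym :
  node_poly x = \sum_(i < d1.+1) ((-1) ^+ i * elem_sym x i) *: 'X^(d1 - i).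
Proof.
have cA (A : {set 'I_d1}) : (#|A| < d1.+1)%N.
  by rewrite ltnS -[leqRHS]card_ord max_card.
rewrite /node_poly; under eq_bigr do rewrite addrC -polyCN.
rewrite bigA_distr 
  (partition_big (fun A : {set 'I_d1} => inord #|A| : 'I_d1.+1) xpredT) //=.
apply: eq_bigr => i _; rewrite /elem_sym mulr_sumr scaler_suml.
apply: eq_big => [A|A]; first by rewrite -val_eqE /= inordK.
rewrite -val_eqE /= inordK // => /eqP Ai; rewrite (bigID (mem A)) /=.
rewrite (eq_bigr (fun j => (-1 * tnth x j)%:P)); last by move=> j ->; rewrite mulN1r.
rewrite [X in _ * X](eq_bigr (fun=> 'X)); last by move=> j /negbTE ->.
rewrite -rmorph_prod big_split /= prodr_const prodr_const mul_polyC Ai.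
suff -> : #|[pred j | j \notin A]| = (d1 - i)%N by [].
by apply/eqP; rewrite -(eqn_add2l i) subnKC -?{1}Ai ?cardC ?card_ord -1?ltnS.
Qed.

Hypothesis d2_gt0 : (0 < d2)%N.

Lemma gpolyE : gpoly d2 x s = 'X^d2 - rVpoly (lambda d2 x s)^T.
Proof.
congr (_ - _); rewrite [RHS](_ : _ = \poly_(i < d2.-1.+1) (rVpoly (lambda d2 x s)^T)`_i).
  by rewrite poly_def; apply: eq_bigr => i _; rewrite coef_rVpoly_ord [in RHS]mxE.
apply/polyP => i; rewrite coef_poly; case: ltnP => // le.
by rewrite nth_default // (leq_trans (size_poly _ _)).
Qed.

Let size_tail : (size (- rVpoly (lambda d2 x s)^T) < size ('X^d2 : {poly R}))%N.
Proof. by rewrite size_polyN size_polyXn ltnS (leq_trans (size_poly _ _)) ?prednK. Qed.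

Lemma size_gpoly : size (gpoly d2 x s) = d2.+1.
Proof. by rewrite gpolyE (size_polyDl size_tail) size_polyXn. Qed.

Lemma gpoly_monic : gpoly d2 x s \is monic.
Proof.
by rewrite gpolyE monicE (lead_coefDl size_tail) lead_coefXn.
Qed.

Lemma size_hpoly : size (hpoly d2 x s) = (d1 + d2).+1.
Proof.
rewrite size_monicM ?node_poly_monic ?monic_neq0 ?gpoly_monic //.
by rewrite size_node_poly size_gpoly addnS.
Qed.

Lemma hpoly_monic : hpoly d2 x s \is monic.
Proof. by rewrite monicMl ?node_poly_monic ?gpoly_monic. Qed.

(** Expanding f in the e_i turns the vector in the definition of [lambda] into these values of L. *)
Lemma Hf_lambda (Hu : Hf d2 x s \in unitmx) (i : 'I_d2.-1.+1) :
  (Hf d2 x s *m lambda d2 x s) i 0 = riesz s (node_poly x * 'X^(d2 + i)).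
Proof.
rewrite mulKVmx // summxE node_poly_elem_sym mulr_suml raddf_sum /=.
apply: eq_bigr => j _; rewrite !mxE -[in RHS]scalerAl [in RHS]linearZ /= -exprD rieszXn.
by congr (_ * s`_ _); have := ltn_ord j; lia.
Qed.

Lemma hpoly_ortho (Hu : Hf d2 x s \in unitmx) i : (i < d2)%N ->
  riesz s (hpoly d2 x s * 'X^i) = 0.
Proof.
rewrite -[X in (_ < X)%N](prednK d2_gt0) => id2.
rewrite /hpoly gpolyE mulrBr mulrBl raddfB /= -[_ * 'X^d2 * _]mulrA -exprD.
have := Hf_lambda Hu (Ordinal id2); rewrite localizing_mulmx /= => <-.
by rewrite mulrAC subrr.
Qed.

(** The difference of two such monic polynomials has degree less than d2 and lies in the kernel of
    [Hf]. *)
Lemma gpoly_unique (Hu : Hf d2 x s \in unitmx) q :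
  q \is monic -> size q = d2.+1 ->
  (forall i, (i < d2)%N -> riesz s (node_poly x * q * 'X^i) = 0) ->
  q = gpoly d2 x s.
Proof.
move=> mq sq q0; apply/eqP; rewrite -subr_eq0; apply/eqP.
move/localizing_unitmxP: (Hu) => Hu0; apply: Hu0 => [|i];
  rewrite (prednK d2_gt0); last first.
  by move=> id2; rewrite mulrBr mulrBl raddfB /= q0 // hpoly_ortho // subrr.
apply/leq_sizeP => i; rewrite leq_eqVlt coefB => /orP[/eqP <-|id2].
  move: mq gpoly_monic; rewrite !monicE /lead_coef sq size_gpoly /= => /eqP -> /eqP ->.
  exact: subrr.
by rewrite !nth_default ?subrr ?sq ?size_gpoly.
Qed.

(** This links recursion and orthogonality: [t] satisfies the recursion at index d1 + d2 + k exactly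
    when its functional kills h x^k. *)
Lemma riesz_hpoly t k :
  riesz t (hpoly d2 x s * 'X^k) =
  t`_(d1 + d2 + k) -
  \sum_(1 <= i < (d1 + d2).+1) phi d2 x s (d1 + d2 - i) * t`_(d1 + d2 + k - i).
Proof.
set N := (d1 + d2)%N; set h := hpoly _ _ _.
have -> : h * 'X^k = 'X^(N + k) - 'X^k * ('X^N - h) by rewrite exprD; ring.
rewrite raddfB /= rieszXn; congr (_ - _).
rewrite (@riesz_mul_expand _ _ _ _ N).
  rewrite big_add1 /= big_mkord (reindex_inj rev_ord_inj) /=.
  apply: eq_bigr => i _; rewrite -exprD rieszXn /phi.
  by congr (_ * t`_ _); have := ltn_ord i; rewrite /N; lia.
apply/leq_sizeP => i; rewrite leq_eqVlt coefB coefXn => /orP[/eqP <-|iN].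
  have := hpoly_monic; rewrite monicE /lead_coef size_hpoly /= eqxx => /eqP ->.
  exact: subrr.
by rewrite gtn_eqF // nth_default ?subrr ?size_hpoly.
Qed.

End Construction.

(** * Entries of the recursive extension *)

Section Extension.
Variable R : realType.
Variables (d1 d2 : nat) (x : d1.-tuple R) (s : seq R).

Lemma size_iter_extend1 k t : size (iter k (extend1 d2 x s) t) = (size t + k)%N.
Proof. by elim: k => [|k IHk] /=; rewrite ?addn0 // size_rcons IHk addnS. Qed.

Lemma nth_iter_extend1 k t i : (i < size t)%N ->
  (iter k (extend1 d2 x s) t)`_i = t`_i.
Proof.
move=> it; elim: k => //= k IHk; rewrite nth_rcons size_iter_extend1.
by rewrite (leq_trans it) ?leq_addr.
Qed.

(** A term satisfies the recursion when appended, and later appends do not change the entries it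
    reads. Nonemptiness of [t] gives i > 0, so that i - j < i. *)
Lemma nth_iter_extend1_rec k t i : (0 < size t)%N ->
  (size t <= i < size t + k)%N ->
  (iter k (extend1 d2 x s) t)`_i =
  \sum_(1 <= j < (d1 + d2).+1)
    phi d2 x s (d1 + d2 - j) * (iter k (extend1 d2 x s) t)`_(i - j).
Proof.
move=> N0; elim: k => [|k IHk]; first by rewrite addn0; lia.
rewrite addnS ltnS [X in _ && X]leq_eqVlt => /andP[ti] /orP[/eqP ik|ik] /=;
  rewrite nth_rcons size_iter_extend1; last first.
  rewrite ik IHk ?ti //; apply: eq_big_nat => j j0; rewrite nth_rcons size_iter_extend1.
  by rewrite (leq_ltn_trans (leq_subr _ _) ik).
rewrite ik ltnn eqxx; apply: eq_big_nat => j /andP[j0 _].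
rewrite nth_rcons size_iter_extend1.
by rewrite ifT //; lia.
Qed.
End Extension.

(** * Orthogonality and moments of the extended sequence *)

Section ExtendedMoments.
Variable R : realType.
Variables (d1 d2 : nat) (x : d1.-tuple R) (s : seq R).
Hypothesis d2_gt0 : (0 < d2)%N.
Hypothesis size_s : size s = (d1 + d2 + d2)%N.

(** For i < d2 only given moments occur, and the choice of [lambda] gives 0. For i at least d2 the
    top index d1 + d2 + i is that of an appended term, and the recursion gives 0. *)
Lemma extension_ortho (Hu : Hf d2 x s \in unitmx) i : (i < d1 + d2 - 1)%N ->
  riesz (extension d2 x s) (hpoly d2 x s * 'X^i) = 0.
Proof.
move=> iN; have [id2|d2i] := ltnP i d2.
  rewrite -(hpoly_ortho d2_gt0 Hu id2); apply: (@eq_riesz _ (size s)).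
    rewrite size_Mmonic ?monicXn ?monic_neq0 ?hpoly_monic //.
    by rewrite size_hpoly // size_polyXn size_s; lia.
  by move=> j js; rewrite nth_iter_extend1.
rewrite riesz_hpoly // nth_iter_extend1_rec ?subrr //; rewrite size_s; first by lia.
by apply/andP; split; lia.
Qed.

(** Since h vanishes at the nodes, the weighted power sums obey the same recursion as the
    extension. *)
Lemma extension_moments (r : seq R) (w : R -> R) :
  {in r, forall z, root (hpoly d2 x s) z} ->
  (forall i, (i < size s)%N -> s`_i = \sum_(z <- r) w z * z ^+ i) ->
  forall i, (i < size s + d1.-1)%N ->
    (extension d2 x s)`_i = \sum_(z <- r) w z * z ^+ i.
Proof.
move=> hr sr; elim/ltn_ind => i IHi ie.
have [si|si] := ltnP i (size s); first by rewrite nth_iter_extend1 // sr.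
have N0 : (0 < d1 + d2)%N by lia.
(* The power sums are stored as a sequence so that [riesz_hpoly] applies to them. *)
pose m := mkseq (fun j => \sum_(z <- r) w z * z ^+ j) i.+1.
have mE j : (j <= i)%N -> m`_j = \sum_(z <- r) w z * z ^+ j.
  by move=> ji; rewrite nth_mkseq.
rewrite -mE // nth_iter_extend1_rec ?si //; last by rewrite size_s; lia.
have iE : i = (d1 + d2 + (i - (d1 + d2)))%N by lia.
apply/esym/eqP; rewrite -subr_eq0 {1}iE.
rewrite [X in _ - X](_ : _ =
   \sum_(1 <= j < (d1 + d2).+1) phi d2 x s (d1 + d2 - j) *
       m`_(d1 + d2 + (i - (d1 + d2)) - j)).
  rewrite -riesz_hpoly // (@riesz_quadrature_sum _ _ r w id i.+1).
  - rewrite big_seq big1 // => z zr.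
    by rewrite hornerM (rootP (hr z zr)) mul0r mulr0.
  - by move=> j ji; exact: mE.
  - rewrite size_Mmonic ?monicXn ?monic_neq0 ?hpoly_monic //.
    by rewrite size_hpoly // size_polyXn; lia.
apply: eq_big_nat => j /andP[j0 jN]; rewrite -iE mE ?leq_subr // IHi //; lia.
Qed.

End ExtendedMoments.

(** * Necessity, and the atoms outside [x] as zeros of g *)

Section Necessity.
Variable R : realType.
Variables (d1 d2 : nat) (x : d1.-tuple R) (s : seq R) (y : seq R) (w : R -> R).
Hypothesis d2_gt0 : (0 < d2)%N.
Hypothesis size_s : size s = (d1 + d2 + d2)%N.
Hypothesis ux : uniq x.
Hypothesis uy : uniq y.
Hypothesis size_y : size y = (d1 + d2)%N.
Hypothesis xy : {subset x <= y}.
Hypothesis w_gt0 : {in y, forall z, 0 < w z}.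
Hypothesis sw : forall i, (i < size s)%N -> s`_i = \sum_(z <- y) w z * z ^+ i.
Implicit Types (p q : {poly R}).

Let z := [seq t <- y | t \notin x].

Let uz : uniq z. Proof. by rewrite filter_uniq. Qed.

Let mem_z t : (t \in z) = (t \notin x) && (t \in y).
Proof. by rewrite mem_filter. Qed.

Let perm_xz : perm_eq y (x ++ z).
Proof.
apply: uniq_perm => //.
  rewrite cat_uniq ux uz andbT; apply/hasPn => t; by rewrite mem_z => /andP[].
move=> t; rewrite mem_cat mem_z; case: (boolP (t \in x)) => [/xy ->|//].
by [].
Qed.

Let size_z : size z = d2.
Proof.
have := perm_size perm_xz; rewrite size_cat size_tuple size_y => /eqP.
by rewrite eqn_add2l => /eqP.
Qed.

(** The nodes in [x] drop out as roots of f; the size bound keeps f p within the d1 + 2 d2 given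
    moments. *)
Let riesz_node p : (size p <= d2.*2)%N ->
  riesz s (node_poly x * p) = \sum_(t <- z) w t * (node_poly x).[t] * p.[t].
Proof.
move=> sp; rewrite (@riesz_quadrature_sum _ _ y w id _ _ _ sw).
  rewrite (perm_big _ perm_xz) big_cat /= big_seq big1 ?add0r.
    by apply: eq_bigr => t _; rewrite hornerM mulrA.
  move=> t tx; rewrite hornerM (rootP (_ : root _ t)) ?mul0r ?mulr0 //.
  by rewrite node_poly_prod root_prod_XsubC.
have [->|p0] := eqVneq p 0; first by rewrite mulr0 size_poly0.
rewrite size_monicM ?node_poly_monic // size_node_poly size_s; lia.
Qed.

(** A kernel element p is tested against the nodal polynomial l of [z] without a. Only the atom a
    survives, so w(a) f(a) p(a) l(a) = 0 and hence p(a) = 0; p then has d2 roots and degree less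
    than d2. *)
Lemma atomic_Hf_unit : Hf d2 x s \in unitmx.
Proof.
apply/localizing_unitmxP; rewrite (prednK d2_gt0) => p sp p0.
apply/(@roots_geq_poly_eq0 _ _ z) => //; last by rewrite size_z.
apply/allP => a az; pose l := \prod_(t <- rem a z) ('X - t%:P).
have sl : size l = d2 by rewrite size_prod_XsubC size_rem // size_z prednK.
have := riesz_mul_eq0 (eq_leq sl) p0; rewrite -mulrA riesz_node.
  rewrite (big_rem _ az) /= big_seq big1 ?addr0.
    have := az; rewrite mem_z => /andP[ax ay].
    move=> /eqP; rewrite hornerM !mulf_eq0 (gt_eqF (w_gt0 ay)).
    have /negbTE -> : (node_poly x).[a] != 0.
      by rewrite -[_ == 0]/(root _ _) node_poly_prod root_prod_XsubC.
    have /negbTE -> : l.[a] != 0.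
      by rewrite -[_ == 0]/(root _ _) root_prod_XsubC mem_rem_uniqF.
    by rewrite /= orbF.
  move=> t ta; rewrite hornerM (rootP (_ : root l t)) ?mulr0 //.
  by rewrite root_prod_XsubC.
rewrite (leq_trans (size_polyMleq _ _)) // sl; lia.
Qed.

(** By [gpoly_unique]: the nodal polynomial of [z] is orthogonal because it vanishes at every atom
    left by f. *)
Lemma atomic_gpoly : gpoly d2 x s = \prod_(t <- z) ('X - t%:P).
Proof.
apply/esym/gpoly_unique; rewrite ?atomic_Hf_unit ?monic_prod_XsubC //.
  by rewrite size_prod_XsubC size_z.
move=> i id2; rewrite -mulrA riesz_node.
  rewrite big1_seq // => t /= tz; rewrite hornerM.
  rewrite (rootP (_ : root (\prod_(a <- z) ('X - a%:P)) t)) ?mul0r ?mulr0 //.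
  by rewrite root_prod_XsubC.
rewrite size_monicM ?monic_prod_XsubC ?monic_neq0 ?monicXn //.
by rewrite size_prod_XsubC size_z size_polyXn; lia.
Qed.

Lemma atomic_gpoly_root t : (t \in y /\ t \notin x) <-> root (gpoly d2 x s) t.
Proof.
by rewrite atomic_gpoly root_prod_XsubC mem_z; split=> [[-> ->]|/andP[]].
Qed.

(** Strictness: a zero value of L(p^2) would make p, of degree less than d1 + d2, vanish at all d1 +
    d2 atoms. *)
Lemma atomic_extension_posdef :
  posdefmx (moment_mx (extension d2 x s) (d1 + d2 - 1)).
Proof.
apply/posdef_momentP => p p0 sp.
have hE : hpoly d2 x s = \prod_(t <- y) ('X - t%:P).
  by rewrite (perm_big _ perm_xz) big_cat /= -node_poly_prod -atomic_gpoly.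
rewrite (@riesz_quadrature_sum _ _ y w id (size s + d1.-1)).
- rewrite big_seq lt0r sumr_ge0 ?andbT; last first.
    by move=> t ty; rewrite hornerM -expr2 mulr_ge0 ?sqr_ge0 // ltW // w_gt0.
  apply: contra_neq p0; rewrite -big_seq => /eqP.
  rewrite big_seq psumr_eq0; last first.
    by move=> t ty; rewrite hornerM -expr2 mulr_ge0 ?sqr_ge0 // ltW // w_gt0.
  move=> /allP py; apply/(@roots_geq_poly_eq0 _ _ y) => //.
    apply/allP => t ty; have := py t ty; rewrite ty /=.
    rewrite hornerM !mulf_eq0 gt_eqF ?w_gt0 //=.
    by rewrite orbb.
  by rewrite size_y (leq_trans sp) //; lia.
- apply: extension_moments => // t ty.
  by rewrite hE root_prod_XsubC.
rewrite (leq_trans (size_polyMleq _ _)) // size_s; lia.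
Qed.

End Necessity.

(** * Atomic measures and their integrals *)

Section AtomicMeasures.
Variable R : realType.
Variables (N : nat) (rho : 'I_N -> R) (y : N.-tuple R).
Implicit Types mu : {measure set (measurableTypeR R) -> \bar R}.

(** [msum] takes a family indexed by [nat], so [rho] is extended by 0; the absolute value makes the
    weight nonnegative for any [rho]. *)
Let weight n : {nonneg R} := `|oapp rho 0 (insub n)|%:nng.
Let term n : {measure set (measurableTypeR R) -> \bar R} :=
  mscale (weight n) (dirac (y`_n : measurableTypeR R)).

Definition atomic_sum : {measure set (measurableTypeR R) -> \bar R} := msum term N.

Hypothesis rho_gt0 : forall j, 0 < rho j.

Let weightE (j : 'I_N) : (weight j)%:num = rho j.
Proof. by rewrite /= valK /= gtr0_norm. Qed.

Lemma atomic_sumE (A : set (measurableTypeR R)) :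
  atomic_sum A = (\sum_(j < N) (rho j)%:E * \d_(tnth y j) A)%E.
Proof.
rewrite /atomic_sum /= /msum; apply: eq_bigr => j _.
by rewrite /term /= /mscale weightE (tnth_nth 0).
Qed.

Lemma ge0_integral_atomic_sum (f : measurableTypeR R -> \bar R) :
  (forall t, 0 <= f t)%E -> measurable_fun [set: measurableTypeR R] f ->
  (\int[atomic_sum]_t f t = \sum_(j < N) (rho j)%:E * f (tnth y j))%E.
Proof.
move=> f0 mf; rewrite ge0_integral_measure_sum //; apply: eq_bigr => j _.
rewrite ge0_integral_mscale // weightE integral_dirac // diracT mul1e.
by rewrite (tnth_nth 0).
Qed.

(** [mu] is known only through its values on measurable sets and is first replaced by [atomic_sum].
    As f may change sign, its positive and negative parts are integrated separately; both integrals
    are finite. *)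
Lemma integral_atomic mu (f : R -> R) :
  (forall A : set (measurableTypeR R), measurable A ->
     mu A = (\sum_(j < N) (rho j)%:E * \d_(tnth y j) A)%E) ->
  measurable_fun [set: measurableTypeR R] f ->
  (\int[mu]_t (f t)%:E)%E = (\sum_(j < N) rho j * f (tnth y j))%:E.
Proof.
move=> muE mf; rewrite (eq_measure_integral atomic_sum); last first.
  by move=> A mA _; rewrite muE // atomic_sumE.
have mf' : measurable_fun [set: measurableTypeR R] (EFin \o f) by exact/measurable_EFinP.
rewrite integralE !ge0_integral_atomic_sum //; last 2 first.
- exact: measurable_funeneg.
- exact: measurable_funepos.
have f_posneg (j : 'I_N) : (rho j * f (tnth y j))%:E =
    (rho j * Num.max (f (tnth y j)) 0 - rho j * Num.max (- f (tnth y j)) 0)%:E.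
  by congr (_%:E); rewrite -mulrBr; congr (_ * _); by case: leP => ?; case: leP => ?; lra.
under eq_bigr do rewrite funeposE -EFin_max -EFinM.
under [X in (_ - X)%E]eq_bigr do rewrite funenegE -EFinN -EFin_max -EFinM.
rewrite !sumEFin -EFinB -sumrB; congr (_%:E); apply: eq_bigr => j _.
by have [] := f_posneg j.
Qed.

End AtomicMeasures.

(** * Representing measures as weighted power sums *)

Section AtomicRepresentation.
Variable R : realType.
Variables (d1 d2 : nat) (x : d1.-tuple R) (s : seq R) (y : (d1 + d2).-tuple R).

Lemma representing_moments (mu : {measure set (measurableTypeR R) -> \bar R}) :
  representing_with_nodes x s mu y ->
  exists w : R -> R, [/\ uniq y, {subset x <= y}, {in y, forall z, 0 < w z}
    & forall i, (i < size s)%N -> s`_i = \sum_(z <- y) w z * z ^+ i].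
Proof.
move=> [[uy [rho [rho0 muE]]] rep xy].
(* Weights become a function on [R], unambiguous since the atoms are distinct; the default 1 is
   taken only off the atoms. *)
pose w z := if [pick j | tnth y j == z] is Some j then rho j else 1.
have wE j : w (tnth y j) = rho j.
  rewrite /w; case: pickP => [k /eqP|/(_ j)]; last by rewrite eqxx.
  by move/(tuple_uniqP _ uy) => ->.
exists w; split=> //.
  by move=> z /tnthP[j ->]; rewrite wE.
move=> i si; have /esym := rep i si.
rewrite (integral_atomic rho0 muE); last by exact: exprn_measurable.
by move=> [->]; rewrite big_tuple; apply: eq_bigr => j _; rewrite wE.
Qed.

Lemma moments_representing (w : R -> R) :
  uniq y -> {subset x <= y} -> {in y, forall z, 0 < w z} ->
  (forall i, (i < size s)%N -> s`_i = \sum_(z <- y) w z * z ^+ i) ->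
  exists mu, representing_with_nodes x s mu y.
Proof.
move=> uy xy w0 sw.
have rho0 (j : 'I_(d1 + d2)) : 0 < w (tnth y j) by rewrite w0 ?mem_tnth.
exists (atomic_sum (fun j => w (tnth y j)) y); split=> //.
  by split=> //; exists (fun j => w (tnth y j)); split=> // A _; exact: atomic_sumE.
move=> i si; rewrite (@integral_atomic _ _ _ y rho0) ?sw // ?big_tuple //.
by move=> A _; exact: atomic_sumE.
Qed.

End AtomicRepresentation.

(** * Sufficiency, and the equivalence *)

Lemma posdef_extension_moments (R : realType) (d1 d2 : nat) (x : d1.-tuple R)
    (s : seq R) :
  (0 < d1)%N -> (0 < d2)%N -> size s = (d1 + d2 + d2)%N ->
  Hf d2 x s \in unitmx ->
  posdefmx (moment_mx (extension d2 x s) (d1 + d2 - 1)) ->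
  exists (y : (d1 + d2).-tuple R) (w : R -> R),
    [/\ uniq y, {subset x <= y}, {in y, forall z, 0 < w z}
      & forall i, (i < size s)%N -> s`_i = \sum_(z <- y) w z * z ^+ i].
Proof.
move=> d1_gt0 d2_gt0 size_s Hu /posdef_momentP pd.
have [n nE] : exists n, (d1 + d2 = n.+2)%N by exists (d1 + d2).-2; lia.
have [||p sp|p p0 sp|r [w [ur hr w0 rw]]] :=
  @gauss_quadrature _ (extension d2 x s) (hpoly d2 x s) n.
- exact: hpoly_monic.
- by rewrite size_hpoly // nE.
- by apply: (riesz_mul_eq0 sp) => i i_n; apply: extension_ortho => //; lia.
- by apply: pd => //; rewrite (leq_trans sp) //; lia.
have size_r : size r == (d1 + d2)%N.
  by rewrite -eqSS -(size_hpoly x s d2_gt0) hr size_prod_XsubC.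
exists (Tuple size_r), w; split=> //.
  (* The prescribed nodes are among the roots of h because f divides h. *)
  move=> t tx; rewrite -[_ \in _]root_prod_XsubC -hr rootM node_poly_prod.
  by rewrite root_prod_XsubC tx.
move=> i si; rewrite -(@nth_iter_extend1 _ _ d2 x s d1.-1 s) // -rieszXn.
(* Here i is at most d1 + 2 d2 - 1, which is within the exactness degree 2 (d1 + d2) - 2 because d1
   is positive. *)
rewrite [LHS]rw; last by rewrite size_polyXn; lia.
by apply: eq_bigr => z _; rewrite hornerXn.
Qed.

Theorem theorem3p1 (R : realType) (d1 d2 D : nat)
  (d1_gt0 : (0 < d1)%N) (d2_gt0 : (0 < d2)%N)
  (defD : D = (d1 + 2 * d2 - 1)%N)
  (x : d1.-tuple R) (x_uniq : uniq x)
  (gamma : D.+1.-tuple R)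
  (gamma_pd : posdefmx (moment_mx gamma D./2)) :
  ((exists (mu : {measure set (measurableTypeR R) -> \bar R})
           (y : (d1 + d2).-tuple R), representing_with_nodes x gamma mu y)
   <->
   (Hf d2 x gamma \in unitmx /\
    posdefmx (moment_mx (extension d2 x gamma) (d1 + d2 - 1)%N)))
  /\
  (forall (mu : {measure set (measurableTypeR R) -> \bar R})
          (y : (d1 + d2).-tuple R),
     representing_with_nodes x gamma mu y ->
     forall t : R, (t \in y /\ t \notin x) <-> root (gpoly d2 x gamma) t).
Proof.
have size_gamma : size gamma = (d1 + d2 + d2)%N.
  by rewrite size_tuple defD; lia.
split; last first.
  move=> mu y /representing_moments[w [uy xy w0 gw]] t.
  exact: (atomic_gpoly_root d2_gt0 size_gamma x_uniq uy (size_tuple y) xy w0 gw).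
split=> [[mu [y /representing_moments[w [uy xy w0 gw]]]]|[Hu pd]].
  split.
    exact: (atomic_Hf_unit d2_gt0 size_gamma x_uniq uy (size_tuple y) xy w0 gw).
  exact: (atomic_extension_posdef d2_gt0 size_gamma x_uniq uy (size_tuple y) xy w0 gw).
have [y [w [uy xy w0 gw]]] := posdef_extension_moments d1_gt0 d2_gt0 size_gamma Hu pd.
by have [mu ?] := moments_representing uy xy w0 gw; exists mu, y.
Qed.
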